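(* Let $\mathbb{G}$ be a finite simple undirected graph with at least one edge, let $\mathfrak{n}_{\mathbb{G}}$ be the complex 2-step nilpotent Lie algebra arising from $\mathbb{G}$, regarded as a real Lie algebra, and let $\langle\cdot,\cdot\rangle$ be its canonical inner product. When the graph $\mathbb{G}$ is connected, the (real vector) space of Killing-Yano tensors on $(\mathfrak{n}_{\mathbb{G}},\langle\cdot,\cdot\rangle)$ has dimension $1$.
   Context: Let $\mathbb{G}$ be a simple undirected graph with set of vertices $S=\{e_1,\ldots,e_n\}$ and set of edges $E=\{z_1,\ldots,z_m\}$, $m\ge 1$. Let $\mathfrak{n}_{\mathbb{G}}^{\mathbb{C}}$ be the complex Lie algebra having $S\cup E$ as a $\mathbb{C}$-basis, with bracket determined by: for $i<j$, $[e_i,e_j]=z_k$ if $z_k$ is the edge joining $e_i$ and $e_j$, and $[e_i,e_j]=0$ if there is no such edge; every $z_k$ is central. Denote by $\mathfrak{n}_{\mathbb{G}}$ the Lie algebra $\mathfrak{n}_{\mathbb{G}}^{\mathbb{C}}$ considered as a real Lie algebra, and let $J$ be its natural bi-invariant complex structure (multiplication by $\sqrt{-1}$). Put $f_i=Je_i$ and $w_k=Jz_k$. The canonical inner product $\langle\cdot,\cdot\rangle$ on $\mathfrak{n}_{\mathbb{G}}$ is the real inner product for which the real basis $\{e_1,f_1,\ldots,e_n,f_n\}\cup\{z_1,w_1,\ldots,z_m,w_m\}$ is orthonormal. For a real Lie algebra $\mathfrak{g}$ with inner product $\langle\cdot,\cdot\rangle$, the Levi-Civita connection is the bilinear map $\nabla:\mathfrak{g}\times\mathfrak{g}\to\mathfrak{g}$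 given by $2\langle\nabla_xy,z\rangle=\langle[x,y],z\rangle-\langle[y,z],x\rangle+\langle[z,x],y\rangle$. A Killing-Yano (KY) tensor on $(\mathfrak{g},\langle\cdot,\cdot\rangle)$ is a real linear map $T:\mathfrak{g}\to\mathfrak{g}$ that is skew-symmetric with respect to $\langle\cdot,\cdot\rangle$ and satisfies $(\nabla_xT)y=-(\nabla_yT)x$ for all $x,y\in\mathfrak{g}$, where $(\nabla_xT)y=\nabla_x(Ty)-T(\nabla_xy)$. *)

(* Defs.v *)
From HB Require Import structures.
From mathcomp Require Import all_boot all_order all_algebra.
From mathcomp Require Import reals.
From mathcomp Require Import complex.
From mathcomp Require Import ring.

Set Implicit Arguments.
Unset Strict Implicit.
Unset Printing Implicit Defensive.
Import Order.TTheory GRing.Theory Num.Theory.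
Local Open Scope ring_scope.
Local Open Scope complex_scope.

(* Rcomplex R is R[i] with R acting by scaling.  The basis (1, 'i) makes it   *)
(* a real vector space of dimension 2, hence so is {ffun I -> Rcomplex R}.    *)
Fact Rcomplex_vect_iso (R : nzRingType) : Vector.axiom 2 (Rcomplex R).
Proof.
pose f (z : Rcomplex R) : 'rV[R]_2 :=
  \row_(j < 2) (if val j == 0%N then complex.Re z else complex.Im z).
exists f.
  move=> a [x y] [x' y']; apply/rowP=> j; rewrite !mxE.
  by case: (val j == 0%N).
exists (fun r : 'rV[R]_2 => (r 0 0 +i* r 0 1 : Rcomplex R)).
  by move=> [x y]; rewrite /f !mxE.
move=> r; apply/rowP=> j; rewrite !mxE.
by case: j => [[|[|//]]] lej /=; congr (r _ _); apply: val_inj.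
Qed.

HB.instance Definition _ (R : nzRingType) :=
  Lmodule_hasFinDim.Build R (Rcomplex R) (@Rcomplex_vect_iso R).

Section MetricLieAlgebra.

Variables (R : realType) (V : vectType R).
Implicit Types (br nabla : V -> V -> V) (ip : V -> V -> R) (T : 'End(V)).

Definition is_lie_bracket br :=
  [/\ forall a x x' y, br (a *: x + x') y = a *: br x y + br x' y,
      forall a x y y', br x (a *: y + y') = a *: br x y + br x y',
      forall x, br x x = 0 &
      forall x y z, br x (br y z) + br y (br z x) + br z (br x y) = 0].

Definition is_inner_product ip :=
  [/\ forall a x x' y, ip (a *: x + x') y = a * ip x y + ip x' y,
      forall x y, ip x y = ip y x &
      forall x, x != 0 -> 0 < ip x x].

Definition is_levi_civita br ip nabla :=
  forall x y z,
    2 * ip (nabla x y) z = ip (br x y) z - ip (br y z) x + ip (br z x) y.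

Definition cov_deriv nabla (x : V) T (y : V) : V :=
  nabla x (T y) - T (nabla x y).

Definition is_killing_yano ip nabla T :=
  (forall x y, ip (T x) y = - ip x (T y)) /\
  (forall x y, cov_deriv nabla x T y = - cov_deriv nabla y T x).

End MetricLieAlgebra.

Section GraphLieAlgebra.

Variables (R : realType) (n : nat) (adj : rel 'I_n).

(* An edge of the graph is represented by its endpoints in increasing order. *)
Definition edge := {p : 'I_n * 'I_n | (p.1 < p.2)%N && adj p.1 p.2}.

Definition gen := ('I_n + edge)%type.

(* The same vectors, seen as a complex and as a real vector space. *)
Definition nC := {ffun gen -> R[i]^o}.
Definition nG := {ffun gen -> Rcomplex R}.

HB.instance Definition _ := GRing.Lmodule.on nC.
HB.instance Definition _ := Vector.on nG.

Definition basis_vec (b : gen) : nC := [ffun c => (c == b)%:R].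
Definition e_ (i : 'I_n) : nC := basis_vec (inl i).
Definition z_ (k : edge) : nC := basis_vec (inr k).

(* The C-bilinear alternating extension of [e_i, e_j] = z_k, where k is the   *)
(* edge joining i < j: see bracket_lin, bracketC_anti, bracket_edge,          *)
(* bracket_nonedge and bracket_central.                                      *)
Definition bracketC (x y : nC) : nC :=
  [ffun c => match c with
             | inl _ => 0
             | inr k => x (inl (val k).1) * y (inl (val k).2)
                        - x (inl (val k).2) * y (inl (val k).1)
             end].

Definition bracket (x y : nG) : nG := bracketC x y.

Definition J (x : nC) : nC := ('i : R[i]) *: x.

(* (b, false) gives the basis vector e_i or z_k, (b, true) gives f_i = J e_i  *)
(* or w_k = J z_k.                                                            *)
Definition real_basis_vec (c : gen * bool) : nG :=
  if c.2 then J (basis_vec c.1) else basis_vec c.1.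

(* The real inner product for which real_basis_vec is orthonormal: see        *)
(* inner_real_basis_vec and real_basis_vec_sum.                               *)
Definition inner (x y : nG) : R :=
  \sum_(b : gen) (complex.Re (x b) * complex.Re (y b)
                  + complex.Im (x b) * complex.Im (y b)).

Lemma bracket_lin (a : R[i]) (x x' y : nC) :
  bracketC (a *: x + x') y = a *: bracketC x y + bracketC x' y.
Proof.
apply/ffunP=> -[i|k]; rewrite !ffunE ?scaler0 ?addr0 //.
rewrite /GRing.scale /=; ring.
Qed.

Lemma bracketC_anti (x y : nC) : bracketC x y = - bracketC y x.
Proof.
apply/ffunP=> -[i|k]; rewrite !ffunE ?oppr0 //.
by rewrite opprB mulrC [X in _ - X]mulrC.
Qed.

Lemma e_inl (i j : 'I_n) : e_ i (inl j) = (j == i)%:R.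
Proof. by rewrite ffunE. Qed.

Lemma bracket_e_ (i j : 'I_n) (k : edge) : bracketC (e_ i) (e_ j) (inr k) =
  (val k == (i, j))%:R - (val k == (j, i))%:R.
Proof.
rewrite ffunE !e_inl -!natrM !mulnb.
by case: (val k) => a b; rewrite !xpair_eqE [(b == i) && _]andbC.
Qed.

Lemma bracket_edge (k : edge) :
  bracketC (e_ (val k).1) (e_ (val k).2) = z_ k.
Proof.
apply/ffunP=> -[i|l]; first by rewrite !ffunE.
rewrite bracket_e_ ffunE -surjective_pairing val_eqE.
have -> : (val l == ((val k).2, (val k).1)) = false; last by rewrite subr0.
have /andP[lt_k _] := valP k; have /andP[lt_l _] := valP l.
by apply/eqP=> E; move: lt_l; rewrite E ltnNge ltnW.
Qed.

Lemma bracket_nonedge (i j : 'I_n) :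
  (i < j)%N -> ~~ adj i j -> bracketC (e_ i) (e_ j) = 0.
Proof.
move=> lt_ij nij; apply/ffunP=> -[i'|l]; first by rewrite !ffunE.
rewrite bracket_e_ [RHS]ffunE; have /andP[lt_l adj_l] := valP l.
have -> : (val l == (i, j)) = false.
  by apply/eqP=> E; move: adj_l; rewrite E (negPf nij).
have -> : (val l == (j, i)) = false; last by rewrite subrr.
by apply/eqP=> E; move: lt_l; rewrite E ltnNge ltnW.
Qed.

Lemma bracket_central (k : edge) (x : nC) : bracketC (z_ k) x = 0.
Proof. by apply/ffunP=> -[i|l]; rewrite !ffunE //= !mul0r subrr. Qed.

Lemma bracket_lie : is_lie_bracket bracket.
Proof.
split.
- move=> a x x' y; apply/ffunP=> -[i|k]; rewrite !ffunE ?scaler0 ?addr0 //.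
  case: (x _) => ? ?; case: (x _) => ? ?; case: (x' _) => ? ?.
  case: (x' _) => ? ?; case: (y _) => ? ?; case: (y _) => ? ?.
  by apply/eqP; rewrite eq_complex /=; apply/andP; split; apply/eqP=> /=; ring.
- move=> a x x' y; apply/ffunP=> -[i|k]; rewrite !ffunE ?scaler0 ?addr0 //.
  case: (x _) => ? ?; case: (x _) => ? ?; case: (x' _) => ? ?.
  case: (x' _) => ? ?; case: (y _) => ? ?; case: (y _) => ? ?.
  by apply/eqP; rewrite eq_complex /=; apply/andP; split; apply/eqP=> /=; ring.
- by move=> x; apply/ffunP=> -[i|k]; rewrite !ffunE // mulrC subrr.
- by move=> x y z; apply/ffunP=> -[i|k]; rewrite !ffunE ?mulr0 ?subrr ?addr0.
Qed.

Lemma inner_inner_product : is_inner_product inner.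
Proof.
split.
- move=> a x x' y; rewrite mulr_sumr -big_split; apply: eq_bigr => b _.
  rewrite !ffunE; case: (x b) => ? ?; case: (x' b) => ? ? /=; ring.
- by move=> x y; apply: eq_bigr => b _; rewrite mulrC [X in _ + X]mulrC.
- move=> x x0; have ge0 b : 0 <= complex.Re (x b) * complex.Re (x b)
      + complex.Im (x b) * complex.Im (x b).
    by rewrite addr_ge0 // -expr2 sqr_ge0.
  rewrite lt_def sumr_ge0 // andbT; apply: contra_neq x0.
  move=> /psumr_eq0P x0; apply/ffunP=> b; rewrite ffunE.
  have /eqP := x0 (fun b _ => ge0 b) b isT.
  rewrite paddr_eq0 -?expr2 ?sqr_ge0 // !sqrf_eq0 => /andP[/eqP re0 /eqP im0].
  by apply/eqP; rewrite eq_complex re0 im0 !eqxx.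
Qed.

Lemma real_basis_vecE c b : real_basis_vec c b =
  if c.1 == b then (if c.2 then 0 +i* 1 else 1 +i* 0) else 0.
Proof.
case: c => a [] /=; rewrite /real_basis_vec /= !ffunE eq_sym;
  case: eqP => //= _.
  by rewrite /GRing.scale /= mulr1.
by rewrite /GRing.scale /= mulr0.
Qed.

Lemma inner_basisr (x : nG) c : inner x (real_basis_vec c) =
  if c.2 then complex.Im (x c.1) else complex.Re (x c.1).
Proof.
rewrite /inner (bigD1 c.1) //= big1 => [|b bc]; rewrite real_basis_vecE.
  by rewrite eqxx; case: c.2 => /=; rewrite !mulr1 !mulr0 ?addr0 ?add0r.
by rewrite eq_sym (negPf bc) /= !mulr0 addr0.
Qed.

Lemma inner_real_basis_vec c d :
  inner (real_basis_vec c) (real_basis_vec d) = (c == d)%:R.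
Proof.
rewrite inner_basisr real_basis_vecE; case: c d => [a s] [b t] /=.
by rewrite xpair_eqE; case: eqP => _; case: s; case: t.
Qed.

Lemma real_basis_vec_sum (x : nG) :
  x = \sum_c inner x (real_basis_vec c) *: real_basis_vec c.
Proof.
have scE (a : R) (v : nG) b : (a *: v) b = a *: v b by rewrite ffunE.
apply/ffunP=> b; rewrite sum_ffunE.
rewrite -(pair_bigA _ (fun a s => (inner x (real_basis_vec (a, s))
  *: real_basis_vec (a, s) : nG) b)) /=.
rewrite (bigD1 b) //= [X in _ + X]big1 ?addr0 => [|a ab].
  rewrite big_bool !scE !inner_basisr !real_basis_vecE /= !eqxx.
  case: (x b) => u v; apply/eqP; rewrite eq_complex /= !(mulr0, mulr1).
  by rewrite add0r addr0 !eqxx.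
by rewrite big_bool !scE !real_basis_vecE /= (negPf ab) !scaler0 addr0.
Qed.

Lemma inner_nondeg (x y : nG) : (forall z, inner x z = inner y z) -> x = y.
Proof.
move=> xy; rewrite (real_basis_vec_sum x) (real_basis_vec_sum y).
by apply: eq_bigr => c _; rewrite xy.
Qed.

Lemma levi_civita_exists :
  exists nabla, is_levi_civita bracket inner nabla.
Proof.
have [ipl ipC _] := inner_inner_product.
have [brl brr _ _] := bracket_lie.
pose K x y z := inner (bracket x y) z - inner (bracket y z) x
                + inner (bracket z x) y.
exists (fun x y =>
  \sum_c (2^-1 * K x y (real_basis_vec c)) *: real_basis_vec c).
move=> x y z.
have ip0 v : inner 0 v = 0.
  by have := ipl (-1) 0 0 v; rewrite scaler0 add0r mulN1r addNr.
have ipsum (F : gen * bool -> R) (G : gen * bool -> nG) v :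
    inner (\sum_c F c *: G c) v = \sum_c F c * inner (G c) v.
  by apply: (big_rec2 (fun u r => inner u v = r)) => [|c p q _ <-];
    rewrite ?ip0 ?ipl.
have Kl a u v : K x y (a *: u + v) = a * K x y u + K x y v.
  rewrite /K brl brr !ipl ![inner (bracket x y) _]ipC !ipl; ring.
have K0 : K x y 0 = 0.
  by have := Kl (-1) 0 0; rewrite scaler0 add0r mulN1r addNr.
rewrite ipsum mulr_sumr -/(K x y z) [in RHS](real_basis_vec_sum z).
rewrite (eq_bigr (fun c =>
  inner z (real_basis_vec c) * K x y (real_basis_vec c))).
  by apply: (big_rec2 (fun r u => r = K x y u)) => [|c p q _ ->];
    rewrite ?K0 ?Kl.
by move=> c _; rewrite !mulrA mulfV ?pnatr_eq0 // mul1r mulrC ipC.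
Qed.

Lemma levi_civita_unique nabla nabla' :
    is_levi_civita bracket inner nabla -> is_levi_civita bracket inner nabla' ->
  forall x y, nabla x y = nabla' x y.
Proof.
move=> L L' x y; apply: inner_nondeg => z.
have /(mulfI _) : 2 * inner (nabla x y) z = 2 * inner (nabla' x y) z.
  by rewrite L L'.
by apply; rewrite pnatr_eq0.
Qed.

End GraphLieAlgebra.

(* Main.v *)
(* Write T in blocks along n = v + z, where v is spanned by the vertices and z
   by the edges: A on v, C on z, B from z to v and minus its transpose from v
   to z.  Paired with vectors of v and z, the Killing-Yano equation makes every
   [B u, x] with u in z orthogonal to z, so B = 0 because no vertex is isolated;
   it then gives [A x, y] = [x, A y] and <[x, y], C u> = -3 <[A x, y], u>.
   Evaluated on C-multiples of vertices, the first identity says that A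
   multiplies each vertex line by a complex scalar, with equal scalars at
   adjacent vertices.  By connectedness and skewness A = t J with t real, and
   the second identity gives C = 3 t J. *)

Require Import Defs.
From HB Require Import structures.
From mathcomp Require Import all_boot all_order all_algebra.
From mathcomp Require Import reals.
From mathcomp Require Import complex.
From mathcomp Require Import ring lra.

Set Implicit Arguments.
Unset Strict Implicit.
Unset Printing Implicit Defensive.
Local Open Scope ring_scope.
Import Order.TTheory GRing.Theory Num.Theory.
Local Open Scope complex_scope.

Section KillingYano.

Variables (R : realType) (n : nat) (adj : rel 'I_n).
Local Notation nG := (nG R adj).
Local Notation br := (@bracket R n adj).
Local Notation ip := (@inner R n adj).
Implicit Types (x y z w : nG) (T : 'End(nG)).

(** * Real bilinearity of the inner product and the bracket *)

Lemma innerC x y : ip x y = ip y x.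
Proof. by have [_ + _] := inner_inner_product R adj; apply. Qed.

Lemma innerDl x x' y : ip (x + x') y = ip x y + ip x' y.
Proof.
by have [+ _ _] := inner_inner_product R adj => /(_ 1 x x' y); rewrite scale1r mul1r.
Qed.

Lemma inner0l y : ip 0 y = 0.
Proof. by apply: (addrI (ip 0 y)); rewrite -innerDl !addr0. Qed.

Lemma innerZl a x y : ip (a *: x) y = a * ip x y.
Proof.
have [+ _ _] := inner_inner_product R adj => /(_ a x 0 y).
by rewrite inner0l !addr0.
Qed.

Lemma innerNl x y : ip (- x) y = - ip x y.
Proof. by rewrite -scaleN1r innerZl mulN1r. Qed.

Lemma innerZr a x y : ip x (a *: y) = a * ip x y.
Proof. by rewrite innerC innerZl innerC. Qed.

Lemma bracketDl x x' y : br (x + x') y = br x y + br x' y.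
Proof.
by have [+ _ _ _] := bracket_lie R adj => /(_ 1 x x' y); rewrite !scale1r.
Qed.

Lemma bracketN x y : br x y = - br y x.
Proof. exact: bracketC_anti. Qed.

Lemma bracketZl a x y : br (a *: x) y = a *: br x y.
Proof.
have b0 : br 0 y = 0 by apply: (addrI (br 0 y)); rewrite -bracketDl !addr0.
have [+ _ _ _] := bracket_lie R adj => /(_ a x 0 y).
by rewrite b0 !addr0.
Qed.

Lemma bracketZr a x y : br x (a *: y) = a *: br x y.
Proof. by rewrite bracketN bracketZl -scalerN -bracketN. Qed.

(** * The Killing-Yano equation without the connection *)

Definition ky_form T x y w : R :=
  ip (br x (T y)) w - ip (br (T y) w) x + ip (br w x) (T y)
  + (ip (br y (T x)) w - ip (br (T x) w) y + ip (br w y) (T x))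
  + 2 * (ip (br (T w) y) x + ip (br (T w) x) y).

(* Twice the Killing-Yano equation paired with w, where skewness moves T off *)
(* the covariant derivatives and Koszul's formula eliminates them.           *)
Lemma killing_yano_form nabla T : is_levi_civita br ip nabla ->
  is_killing_yano ip nabla T <->
  (forall x y, ip (T x) y = - ip x (T y)) /\
  (forall x y w, ky_form T x y w = 0).
Proof.
move=> LC; rewrite /is_killing_yano.
have key x y w : (forall x y, ip (T x) y = - ip x (T y)) ->
    ky_form T x y w =
    2 * (ip (cov_deriv nabla x T y) w - ip (- cov_deriv nabla y T x) w).
  move=> skew; rewrite /cov_deriv !(innerNl, innerDl) !skew.
  rewrite mulrBr mulrN !mulrDr !mulrN !LC /ky_form.
  rewrite (bracketN y x) (bracketN x (T w)) (bracketN y (T w)) !innerNl.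
  ring.
split=> -[skew KY]; split=> // x y.
- by move=> w; rewrite key // KY subrr mulr0.
- apply: inner_nondeg => w; have := key x y w skew.
  rewrite KY => /esym/eqP; rewrite mulf_eq0 pnatr_eq0 /= subr_eq0 => /eqP->.
  by [].
Qed.

(** * An explicit Killing-Yano tensor *)

(** This is [J] on the vertex span and [3 J] on the edge span; [ky_edge] shows that the ratio 3 is
    forced. *)
Definition ky_fun x : nG :=
  [ffun c : gen adj => match c with
           | inl i => ('i : R[i]) * x (inl i)
           | inr k => (3 * 'i : R[i]) * x (inr k)
           end].

Fact ky_fun_linear : linear ky_fun.
Proof.
move=> a x y; apply/ffunP=> -[i|k]; rewrite !ffunE;
  case: (x _) => ? ?; case: (y _) => ? ?;
  by apply/eqP; rewrite eq_complex /=; apply/andP; split; apply/eqP=> /=; ring.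
Qed.

HB.instance Definition _ := GRing.isLinear.Build R nG nG *:%R ky_fun ky_fun_linear.

Definition ky_map : 'End(nG) := linfun ky_fun.

Lemma inner_bracket x y w : ip (br x y) w = \sum_(k : edge adj)
  (complex.Re (br x y (inr k)) * complex.Re (w (inr k)) +
   complex.Im (br x y (inr k)) * complex.Im (w (inr k))).
Proof.
rewrite /inner big_sumType /= big1 ?add0r // => i _.
by rewrite !ffunE /= !mul0r addr0.
Qed.

Lemma ky_map_skew x y : ip (ky_map x) y = - ip x (ky_map y).
Proof.
rewrite /ky_map !lfunE /= /inner -sumrN; apply: eq_bigr => -[i|k] _; rewrite !ffunE;
  case: (x _) => ? ?; case: (y _) => ? ? /=; ring.
Qed.

Lemma ky_map_form x y w : ky_form ky_map x y w = 0.
Proof.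
rewrite /ky_form /ky_map !lfunE /= !inner_bracket.
(* Every term pairs a bracket with a vector, so the form is a sum over edges. Each summand vanishes
   as a polynomial in the coordinates at the edge and its two endpoints. *)
rewrite mulrDr !mulr_sumr -!sumrN -!big_split /=; apply: big1 => k _.
rewrite !ffunE.
case: (x _) => ? ?; case: (x _) => ? ?; case: (x _) => ? ?.
case: (y _) => ? ?; case: (y _) => ? ?; case: (y _) => ? ?.
case: (w _) => ? ?; case: (w _) => ? ?; case: (w _) => ? ? /=.
ring.
Qed.


(** * Coordinates and the splitting into vertex span and edge span *)

(** The result type is the field [R[i]], where coordinates get multiplied, rather than the real
    vector space [Rcomplex R]. *)
Definition coord x (b : gen adj) : R[i] := x b.

Definition single (b : gen adj) (a : R[i]) : nG :=
  [ffun c => if c == b then a else 0].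

Lemma coord_single b a c : coord (single b a) c = if c == b then a else 0.
Proof. by rewrite /coord ffunE. Qed.

Lemma inner_single x b a : ip x (single b a) =
  complex.Re (coord x b) * complex.Re a + complex.Im (coord x b) * complex.Im a.
Proof.
rewrite /inner (bigD1 b) //= big1 ?addr0 => [|c /negPf cb].
  by rewrite ffunE eqxx.
by rewrite ffunE cb /= !mulr0 addr0.
Qed.

Lemma sum_single x : x = \sum_b single b (coord x b).
Proof.
apply/ffunP=> c; rewrite sum_ffunE (bigD1 c) //= big1 ?addr0 => [|b bc].
  by rewrite ffunE eqxx.
by rewrite ffunE eq_sym (negPf bc).
Qed.

Lemma coord_bracket x y k : coord (br x y) (inr k) =
  coord x (inl (val k).1) * coord y (inl (val k).2)
  - coord x (inl (val k).2) * coord y (inl (val k).1).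
Proof. by rewrite /coord /bracket ffunE. Qed.

Definition vertical x := forall k, coord x (inr k) = 0.
(** This is the edge span, orthogonal to [vertical]. It is the whole center once no vertex is
    isolated. *)
Definition central x := forall i, coord x (inl i) = 0.

Lemma bracket_is_central x y : central (br x y).
Proof. by move=> i; rewrite /coord /bracket ffunE. Qed.

Lemma central_bracketl z x : central z -> br z x = 0.
Proof.
move=> zc; apply/ffunP=> -[i|k]; first by rewrite !ffunE.
by have := coord_bracket z x k; rewrite !zc !mul0r subrr /coord => ->; rewrite ffunE.
Qed.

Lemma central_bracketr z x : central z -> br x z = 0.
Proof. by move=> zc; rewrite bracketN central_bracketl ?oppr0. Qed.

Lemma inner_central_vertical z x : central z -> vertical x -> ip z x = 0.
Proof.
move=> zc xv; apply: big1 => -[i|k] _.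
  by have := zc i; rewrite /coord => ->; rewrite /= !mul0r addr0.
by have := xv k; rewrite /coord => ->; rewrite /= !mulr0 addr0.
Qed.

Lemma inner_self_eq0 x : ip x x = 0 -> x = 0.
Proof.
have [_ _ pos] := inner_inner_product R adj => x0.
by apply/eqP; apply: contra_eqT x0 => /pos; rewrite lt_def => /andP[].
Qed.

Lemma vertical_single i a : vertical (single (inl i) a).
Proof. by move=> k; rewrite coord_single. Qed.

Lemma central_single k a : central (single (inr k) a).
Proof. by move=> i; rewrite coord_single. Qed.

Lemma bracket_single_edge (k : edge adj) (a : R[i]) :
  br (single (inl (val k).1) a) (single (inl (val k).2) 1) = single (inr k) a.
Proof.
apply/ffunP=> -[i|l]; first by rewrite !ffunE.
rewrite -!/(coord _ _) coord_bracket !coord_single.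
have /andP[lt_k _] := valP k; have /andP[lt_l _] := valP l.
rewrite !(inj_eq inl_inj) (inj_eq inr_inj).
have -> : (l == k) = ((val l).1 == (val k).1) && ((val l).2 == (val k).2).
  by rewrite -val_eqE -xpair_eqE -!surjective_pairing.
(* A crossed match would list the endpoints of [l] in decreasing order. *)
have : ~~ (((val l).2 == (val k).1) && ((val l).1 == (val k).2)).
  by apply: contraL lt_l => /andP[/eqP-> /eqP->]; rewrite -leqNgt ltnW.
case: (_ == _); case: (_ == _); case: (_ == _); case: (_ == _) => //= _;
  by rewrite ?mulr0 ?mul0r ?mulr1 ?subr0.
Qed.

(** Swapping [i] and [j] negates both sides, so later arguments can ignore the order in which an
    edge stores its endpoints. *)
Lemma adj_bracket_eq x y x' y' i j : symmetric adj -> irreflexive adj ->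
    adj i j -> br x y = br x' y' ->
  coord x (inl i) * coord y (inl j) - coord x (inl j) * coord y (inl i) =
  coord x' (inl i) * coord y' (inl j) - coord x' (inl j) * coord y' (inl i).
Proof.
move=> adj_sym adj_irr; wlog lt_ij : i j / (i < j)%N => [wl aij eb|].
  have : i != j by apply: contraTneq aij => ->; rewrite adj_irr.
  rewrite -val_eqE neq_ltn => /orP[lt_ij|lt_ji]; first exact: wl.
  rewrite -[LHS]opprB -[RHS]opprB; congr (- _); apply: wl => //.
  by rewrite adj_sym.
move=> aij eb; have kP : ((i, j).1 < (i, j).2)%N && adj (i, j).1 (i, j).2.
  by rewrite /= lt_ij aij.
by have := congr1 (coord^~ (inr (Sub (i, j) kP))) eb; rewrite !coord_bracket.
Qed.

(** * Rigidity: every Killing-Yano tensor is a real multiple of [ky_map] *)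

Section Rigidity.

Hypotheses (adj_sym : symmetric adj) (adj_irr : irreflexive adj).
Hypotheses (adj_edge : exists i j, adj i j).
Hypothesis adj_conn : forall i j, connect adj i j.
Variable T : 'End(nG).
Hypothesis T_skew : forall x y, ip (T x) y = - ip x (T y).
Hypothesis T_form : forall x y w, ky_form T x y w = 0.

Lemma has_neighbour i : exists j, adj i j.
Proof.
have [p [q pq]] := adj_edge.
have /connectP[[|j s] /=] := adj_conn i p; first by move=> _ <-; exists q.
by move=> /andP[ij _] _; exists j.
Qed.

Lemma ky_central z : central z -> central (T z).
Proof.
move=> zc; have b0 x : br (T z) x = 0.
  set u := br (T z) x; have uc : central u by exact: bracket_is_central.
  apply: inner_self_eq0.
  (* With c = <[x, T u], z>, the first instance gives c = -2 <u, u> and the second c = <u, u>. *)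
  have := T_form x u z; have := T_form u z x; rewrite /ky_form.
  rewrite !(central_bracketl _ zc, central_bracketr _ zc, central_bracketl _ uc,
    central_bracketr _ uc) !inner0l (bracketN x (T u)) !innerNl -/u.
  lra.
move=> i; have [j ij] := has_neighbour i.
(* Bracketing [T z] with the neighbour [j] leaves, at the edge between [i] and [j], only the
   coordinate of [T z] at [i], up to sign. *)
have := adj_bracket_eq adj_sym adj_irr ij (etrans (b0 (single (inl j) 1)) (esym (b0 0))).
rewrite !coord_single eqxx (inj_eq inl_inj).
have /negPf-> : i != j by apply: contraTneq ij => ->; rewrite adj_irr.
by rewrite /coord !ffunE !mulr0 mulr1 subr0 subrr.
Qed.

(** A skew map preserving the edge span preserves its orthogonal complement. *)
Lemma ky_vertical x : vertical x -> vertical (T x).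
Proof.
move=> xv k.
have h a : ip (T x) (single (inr k) a) = 0.
  rewrite T_skew innerC inner_central_vertical ?oppr0 //.
  exact/ky_central/central_single.
have := h 1; have := h 'i; rewrite !inner_single /= !mulr0 !mulr1 addr0 add0r.
by case: (coord _ _) => u v /= -> ->.
Qed.

Lemma ky_bracket x y : vertical x -> vertical y -> br x (T y) = br (T x) y.
Proof.
move=> xv yv; apply/eqP; rewrite -subr_eq0; apply/eqP.
set u := _ - _; have uc : central u.
  by move=> i; rewrite /coord !ffunE subrr.
(* Only <[x, T y] + [y, T x], u> = <u, u> survives: the other terms bracket with [u] or pair a
   bracket with a vertex vector. *)
apply: inner_self_eq0; have := T_form x y u; rewrite /ky_form.
rewrite !(central_bracketl _ uc, central_bracketr _ uc) !inner0l.
rewrite !(inner_central_vertical (bracket_is_central _ _) xv).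
rewrite !(inner_central_vertical (bracket_is_central _ _) yv).
by rewrite (bracketN y) innerNl innerDl innerNl !(addr0, mulr0, subr0).
Qed.

Lemma ky_coord_eq x y i j : vertical x -> vertical y -> adj i j ->
  coord x (inl i) * coord (T y) (inl j) - coord x (inl j) * coord (T y) (inl i) =
  coord (T x) (inl i) * coord y (inl j) - coord (T x) (inl j) * coord y (inl i).
Proof.
by move=> xv yv ij; apply: adj_bracket_eq => //; exact: ky_bracket.
Qed.

Let vs := vertical_single.

Lemma ky_offdiag i p a : i != p -> coord (T (single (inl p) a)) (inl i) = 0.
Proof.
move=> /negPf ip; have [j ij] := has_neighbour i.
have /negPf ji : i != j by apply: contraTneq ij => ->; rewrite adj_irr.
have h b b' := ky_coord_eq (vs p b) (vs j b') ij.
(* If [j] differs from [p], testing against the vertex [j] isolates the wanted coordinate. Otherwise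
   two multiples of [p] are compared: [E] at (1, 1) kills [f 1], then [E] at (a, 1) kills [f a]. *)
have [jp|/negPf jp] := eqVneq j p; last first.
  by have := h a 1; rewrite !coord_single !(inj_eq inl_inj) eqxx ip jp ji
    !mul0r !mulr0 mulr1 !subr0 => <-.
set f := fun b => coord (T (single (inl p) b)) (inl i).
have E b b' : - (b * f b') = f b * b'.
  have := h b b'; rewrite !coord_single !(inj_eq inl_inj) jp eqxx ip.
  by rewrite mul0r mulr0 sub0r subr0.
have f1 : f 1 = 0.
  apply/eqP; have /eqP := E 1 1.
  by rewrite mul1r mulr1 eq_sym -addr_eq0 -mulr2n mulrn_eq0.
by have := E a 1; rewrite f1 mulr0 oppr0 mulr1 => /esym.
Qed.

Definition ky_eig i := coord (T (single (inl i) 1)) (inl i).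

(** [T] is only real-linear, but here the variables separate: [b = 1] yields complex linearity on
    the line of [i], and [a = b = 1] equal scalars at neighbours. *)
Lemma ky_diag_adj i j a b : adj i j ->
  a * coord (T (single (inl j) b)) (inl j) =
  coord (T (single (inl i) a)) (inl i) * b.
Proof.
move=> ij; have /negPf ji : i != j by apply: contraTneq ij => ->; rewrite adj_irr.
have := ky_coord_eq (vs i a) (vs j b) ij.
by rewrite !coord_single !(inj_eq inl_inj) !eqxx (eq_sym j) ji mul0r mulr0 !subr0.
Qed.

Lemma ky_eig_const i j : ky_eig i = ky_eig j.
Proof.
have /connectP[s] := adj_conn i j; elim: s i => [|k s IHs] i /=; first by move=> _ ->.
move=> /andP[ik ks] /(IHs _ ks) <-.
by have := ky_diag_adj 1 1 ik; rewrite mul1r mulr1.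
Qed.

Lemma ky_diag i a : coord (T (single (inl i) a)) (inl i) = a * ky_eig i.
Proof.
have [j ij] := has_neighbour i.
by rewrite (ky_eig_const i j) /ky_eig (ky_diag_adj _ _ ij) mulr1.
Qed.

Lemma ky_eig_imag i : complex.Re (ky_eig i) = 0.
Proof.
have := T_skew (single (inl i) 1) (single (inl i) 1).
rewrite [in RHS]innerC inner_single -/(ky_eig i) /= mulr1 mulr0 addr0; lra.
Qed.

Lemma ky_edge z k : central z ->
  coord (T z) (inr k) = 3 * ky_eig (val k).1 * coord z (inr k).
Proof.
move=> zc; set l := ky_eig _.
have h a : ip (single (inr k) a) (T z) + 3 * ip (single (inr k) (a * l)) z = 0.
  set x := single (inl (val k).2) 1; set y := single (inl (val k).1) a.
  have xv : vertical x by exact: vs. have yv : vertical y by exact: vs.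
  have Ty : T y = single (inl (val k).1) (a * l).
    apply/ffunP=> -[i|m]; rewrite -![LHS]/(coord _ _) -![RHS]/(coord _ _).
      rewrite coord_single (inj_eq inl_inj).
      by have [->|/ky_offdiag->] := eqVneq i (val k).1; rewrite ?ky_diag.
    by rewrite coord_single; apply: ky_vertical.
  have bT : br (T y) x = single (inr k) (a * l) by rewrite Ty bracket_single_edge.
  have bTx : br (T x) y = - single (inr k) (a * l).
    by rewrite -ky_bracket // bracketN bT.
  (* The 3 is 2 + 1: the doubled term gives <[T y, x], z> twice, and -<[T x, y], z> equals it once
     more. *)
  have := T_form x z y; rewrite /ky_form bT bTx bracket_single_edge.
  rewrite !(central_bracketl _ zc, central_bracketr _ zc,
    central_bracketl _ (ky_central zc), central_bracketr _ (ky_central zc)).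
  rewrite !inner0l innerNl; lra.
(* Multiplication by the imaginary scalar [l] is skew, which turns the sign; [a = 1] and [a = 'i]
   give the real and imaginary parts. *)
have l0 : complex.Re l = 0 by exact: ky_eig_imag.
have := h 1; have := h 'i; rewrite !(innerC (single _ _)) !inner_single.
move: l0; case: l {h} => u v /= ->; case: (coord (T z) _) => p q.
case: (coord z _) => r s /= h1 h2.
apply/eqP; rewrite eq_complex /=; apply/andP; split; apply/eqP => /=; lra.
Qed.

Lemma ky_line : T \in <[ky_map]>%VS.
Proof.
have [i0 _] := adj_edge; pose t := complex.Im (ky_eig i0).
have eigE i : ky_eig i = 0 +i* t.
  rewrite (ky_eig_const i i0) /t; have := ky_eig_imag i0.
  by case: (ky_eig i0) => u v /= ->.
(* By additivity it suffices to compare both maps on complex multiples of single generators, block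
   by block. *)
apply/vlineP; exists t; apply/lfunP=> x; rewrite (sum_single x) !linear_sum.
apply: eq_bigr => b _; move: (coord x b) => a {x}.
rewrite [RHS](scale_lfunE t) /ky_map lfunE /=.
case: b => [p|k]; apply/ffunP=> -[i|l]; rewrite -[LHS]/(coord _ _).
- have [->|ip] := eqVneq i p; last first.
    by rewrite (ky_offdiag _ ip) !ffunE (inj_eq inl_inj) (negPf ip) mulr0 scaler0.
  rewrite ky_diag eigE !ffunE eqxx; case: a => u v.
  by apply/eqP; rewrite eq_complex /=; apply/andP; split; apply/eqP=> /=; ring.
- by rewrite (ky_vertical (vs p a)) !ffunE mulr0 scaler0.
- by rewrite (ky_central (central_single k a)) !ffunE mulr0 scaler0.
- rewrite (ky_edge _ (central_single k a)) eigE coord_single !ffunE.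
  case: eqP => _; last by rewrite !mulr0 scaler0.
  case: a => u v.
  by apply/eqP; rewrite eq_complex /=; apply/andP; split; apply/eqP=> /=; ring.
Qed.

End Rigidity.

(** * The space of Killing-Yano tensors is a line *)

Lemma ky_map_neq0 (i : 'I_n) : ky_map != 0.
Proof.
apply/eqP => /lfunP/(_ (single (inl i) 1))/ffunP/(_ (inl i)).
rewrite /ky_map lfunE lfunE /= !ffunE eqxx mulr1 => /eqP.
by rewrite eq_complex /= oner_eq0 andbF.
Qed.

Lemma killing_yano_scale nabla a T : is_levi_civita br ip nabla ->
  is_killing_yano ip nabla T -> is_killing_yano ip nabla (a *: T).
Proof.
move=> LC; rewrite !(killing_yano_form _ LC) => -[skew KY]; split=> x y.
  by rewrite !scale_lfunE innerZl innerZr skew mulrN.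
move=> w; rewrite -[RHS](mulr0 a) -(KY x y w) /ky_form !scale_lfunE.
rewrite !(bracketZl, bracketZr) !(innerZl, innerZr); ring.
Qed.

End KillingYano.

Theorem theorem4p1 (R : realType) (n : nat) (adj : rel 'I_n)
    (adj_sym : symmetric adj) (adj_irr : irreflexive adj)
    (adj_edge : exists i j : 'I_n, adj i j)
    (adj_conn : forall i j : 'I_n, connect adj i j)
    (nabla : nG R adj -> nG R adj -> nG R adj)
    (nabla_LC : is_levi_civita (@bracket R n adj) (@inner R n adj) nabla) :
  exists KY : {vspace 'End(nG R adj)},
    (forall T : 'End(nG R adj),
       T \in KY <-> is_killing_yano (@inner R n adj) nabla T) /\
    \dim KY = 1%N.
Proof.
have [i0 _] := adj_edge.
exists <[ky_map R adj]>%VS; split; last by rewrite dim_vline (ky_map_neq0 R adj i0).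
move=> T; split=> [/vlineP[t ->]|].
  apply: killing_yano_scale => //; apply/(killing_yano_form _ nabla_LC).
  by split; [exact: ky_map_skew | exact: ky_map_form].
move=> /(killing_yano_form _ nabla_LC)[skew form]; exact: ky_line.
Qed.
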